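(* Any three-dimensional solvable subalgebra of $\mathfrak{b}$ containing a semisimple element with eigenvalues $1,1,-1,-1$ but not containing a Cartan subalgebra is equivalent to one of the following inequivalent algebras: $$\langle T_{1,-1},X_{\alpha+\beta},X_{\alpha+2\beta}\rangle\sim\langle T_{1,1},X_{\beta},X_{\alpha+2\beta}\rangle,$$ $$\langle T_{1,-1},X_{\alpha},X_{\alpha+2\beta}\rangle,$$ $$\langle T_{1,-1},X_{\beta},X_{\alpha+2\beta}\rangle\sim\langle T_{1,1},X_{\alpha+\beta},X_{\alpha+2\beta}\rangle,$$ $$\langle T_{1,1},X_{\alpha},X_{\alpha+2\beta}\rangle .$$ (Algebras on the same line are equivalent; algebras on different lines are inequivalent.)
   Context: Let $J=\begin{pmatrix}0&0&1&0\\0&0&0&1\\-1&0&0&0\\0&-1&0&0\end{pmatrix}$. $\mathfrak{sp}(4,\mathbb{C})$ is the Lie algebra of $4\times4$ complex matrices $X$ with $JX^tJ=X$, and $Sp(4,\mathbb{C})=\{g\in GL(4,\mathbb{C}) : gJg^t=J\}$, acting on $\mathfrak{sp}(4,\mathbb{C})$ by conjugation $X\mapsto gXg^{-1}$. For $a,b\in\mathbb{C}$, $T_{a,b}=\mathrm{diag}(a,b,-a,-b)$, and $\mathfrak{t}=\{T_{a,b}: a,b\in\mathbb{C}\}$. A Cartan subalgebra of $\mathfrak{sp}(4,\mathbb{C})$ is a two-dimensional subalgebra of commuting semisimple (diagonalizable) elements. With $E_{ij}$ the matrix units, $X_\alpha=E_{24}$, $X_\beta=E_{12}-E_{43}$,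 $X_{\alpha+\beta}=E_{14}+E_{23}$, $X_{\alpha+2\beta}=E_{13}$. $\langle\,\cdot\,\rangle$ denotes the complex linear span. $\mathfrak{b}=\mathfrak{t}\oplus\langle X_\alpha,X_\beta,X_{\alpha+\beta},X_{\alpha+2\beta}\rangle$ is the Borel subalgebra. Two subalgebras are equivalent, written $\sim$, if some $g\in Sp(4,\mathbb{C})$ conjugates one onto the other. *)

(* Defs.v *)
From HB Require Import structures.
From mathcomp Require Import all_boot all_algebra.
Set Implicit Arguments.
Unset Strict Implicit.
Unset Printing Implicit Defensive.

Import GRing.Theory.
Local Open Scope ring_scope.

(* Complex Lie algebras are handled as subspaces ({vspace 'M[F]_n}) of the
   square matrices, over a field F that is later taken to be the complex
   numbers. *)

Definition lie (F : fieldType) (n : nat) (X Y : 'M[F]_n) : 'M[F]_n :=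
  X *m Y - Y *m X.

Definition lie_subalgebra (F : fieldType) (n : nat) (S : {vspace 'M[F]_n}) :
    Prop :=
  forall X Y : 'M[F]_n, X \in S -> Y \in S -> lie X Y \in S.

(* [S, S]; by bilinearity the brackets of basis elements are enough, see
   derived_algebraP. *)
Definition derived_algebra (F : fieldType) (n : nat) (S : {vspace 'M[F]_n}) :
    {vspace 'M[F]_n} :=
  <<[seq lie X Y | X <- vbasis S, Y <- vbasis S]>>%VS.

Definition lie_solvable (F : fieldType) (n : nat) (S : {vspace 'M[F]_n}) :
    Prop :=
  exists k : nat, iter k (@derived_algebra F n) S = 0%VS.

Definition semisimple (F : fieldType) (n : nat) (X : 'M[F]_n) : Prop :=
  diagonalizable X.

Definition sympJ (F : fieldType) : 'M[F]_4 :=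
  \matrix_(i < 4, j < 4)
    (nth [::] [:: [::  0;  0; 1; 0];
                  [::  0;  0; 0; 1];
                  [:: -1;  0; 0; 0];
                  [::  0; -1; 0; 0]] i)`_j.

Definition in_sp4 (F : fieldType) (X : 'M[F]_4) : Prop :=
  sympJ F *m X^T *m sympJ F = X.

Definition in_Sp4 (F : fieldType) (g : 'M[F]_4) : Prop :=
  g \in unitmx /\ g *m sympJ F *m g^T = sympJ F.

(* The image g S g^-1 of the subspace S. *)
Definition conj_vspace (F : fieldType) (g : 'M[F]_4) (S : {vspace 'M[F]_4}) :
    {vspace 'M[F]_4} :=
  (linfun (mulmxr (invmx g) \o mulmx g) @: S)%VS.

Definition sp4_equiv (F : fieldType) (S S' : {vspace 'M[F]_4}) : Prop :=
  exists2 g : 'M[F]_4, in_Sp4 g & conj_vspace g S = S'.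

Definition cartan_subalgebra (F : fieldType) (H : {vspace 'M[F]_4}) : Prop :=
  [/\ \dim H = 2%N, lie_subalgebra H,
      forall X, X \in H -> in_sp4 X /\ semisimple X
    & forall X Y, X \in H -> Y \in H -> lie X Y = 0].

(* Matrix units with the indices i, j counted from 1 to 4. *)
Definition E (F : fieldType) (i j : nat) : 'M[F]_4 :=
  delta_mx (inord i.-1) (inord j.-1).

Definition T (F : fieldType) (a b : F) : 'M[F]_4 :=
  diag_mx (\row_(i < 4) [:: a; b; - a; - b]`_i).

Definition Xa (F : fieldType) : 'M[F]_4 := E F 2 4.
Definition Xb (F : fieldType) : 'M[F]_4 := E F 1 2 - E F 4 3.
Definition Xab (F : fieldType) : 'M[F]_4 := E F 1 4 + E F 2 3.
Definition Xa2b (F : fieldType) : 'M[F]_4 := E F 1 3.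

(* {T_{a,b}}, see torusP. *)
Definition torus (F : fieldType) : {vspace 'M[F]_4} :=
  <<[:: T 1 0; T 0 1]>>%VS.

Definition borel (F : fieldType) : {vspace 'M[F]_4} :=
  (torus F + <<[:: Xa F; Xb F; Xab F; Xa2b F]>>)%VS.

Lemma derived_algebraP (F : fieldType) (n : nat) (S D : {vspace 'M[F]_n}) :
  (derived_algebra S <= D)%VS <->
  (forall X Y, X \in S -> Y \in S -> lie X Y \in D).
Proof.
split=> [sSD X Y XS YS | clD]; last first.
  apply/span_subvP=> Z /allpairsP[[X Y] /= [XS YS ->]].
  by apply: clD; apply: vbasis_mem.
apply: (subvP sSD); rewrite (coord_vbasis XS) (coord_vbasis YS) /lie.
rewrite mulmx_suml mulmx_sumr -sumrB /=.
rewrite (eq_bigr (fun i => \sum_j (coord (vbasis S) i X * coord (vbasis S) j Y)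
   *: lie (vbasis S)`_i (vbasis S)`_j)); last first.
  move=> i _; rewrite mulmx_sumr mulmx_suml -sumrB; apply: eq_bigr => j _.
  rewrite -!scalemxAl -!scalemxAr !scalerA /lie scalerBr.
  by rewrite [X in _ - X *: _ = _]mulrC.
apply: rpred_sum => i _; apply: rpred_sum => j _; apply/rpredZ/memv_span.
apply/allpairsP; exists ((vbasis S)`_i, (vbasis S)`_j).
by rewrite /= !mem_nth ?size_tuple.
Qed.

Lemma conj_vspaceP (F : fieldType) (g : 'M[F]_4) (S : {vspace 'M[F]_4}) Y :
  reflect (exists2 X, X \in S & Y = g *m X *m invmx g) (Y \in conj_vspace g S).
Proof.
by apply: (iffP memv_imgP) => -[X XS ->]; exists X => //; rewrite lfunE.
Qed.

Lemma torusP (F : fieldType) (X : 'M[F]_4) :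
  X \in torus F <-> exists a b, X = T a b.
Proof.
have TE a b : T a b = a *: T 1 0 + b *: T 0 1 :> 'M[F]_4.
  apply/matrixP=> i j; rewrite !mxE.
  case: (i == j); rewrite ?mulr0n ?mulr0 ?addr0 // !mulr1n.
  case: i => -[|[|[|[|//]]]] ? /=;
    rewrite ?(oppr0, mulr0, mulr1, mulrN, addr0, add0r) //.
rewrite /torus span_cons span_seq1; split=> [/memv_addP|[a [b ->]]].
  by case=> _ /vlineP[a ->] [_ /vlineP[b ->] ->]; exists a, b; rewrite -TE.
by rewrite [T a b]TE memv_add // memvZ // memv_line.
Qed.

(* Main.v *)
(* A semisimple X with eigenvalues 1, 1, -1, -1 is an involution, and an
   involution of the Borel subalgebra is conjugate to T_{1,1} or T_{1,-1}, up to
   sign, by a unipotent element of the Borel subgroup.  Once T_{1,1} or T_{1,-1}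
   lies in S, S is the direct sum of its intersections with the eigenspaces of
   ad T; without a Cartan subalgebra, S meets the centralizer of T in <T> or in
   <T, root vector>.  Only planes of root vectors then remain: for T_{1,1} they
   are planes of binary quadratic forms, which have up to GL_2 one or two lines
   of degenerate forms.
   The four classes are separated by three properties: a nonzero center (first
   line), an X having both 1 and -1 as eigenvalues of ad X (second line), and
   two elements of rank one whose sum has rank two (fourth versus third line). *)
Require Import Defs.
From HB Require Import structures.
From mathcomp Require Import all_boot all_algebra.
From mathcomp Require Import reals complex.
From mathcomp Require Import ring.
Set Implicit Arguments.
Unset Strict Implicit.
Unset Printing Implicit Defensive.

Import GRing.Theory Num.Theory.
Local Open Scope ring_scope.

(** * Explicit 4 x 4 matrices *)

(** Explicit entries reduce each matrix identity below to sixteen scalar ones, within reach of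
    [congr mx4; ring]. *)
Definition mx4 (F : fieldType)
    (a00 a01 a02 a03 a10 a11 a12 a13 a20 a21 a22 a23 a30 a31 a32 a33 : F) :
    'M[F]_4 :=
  \matrix_(i < 4, j < 4)
    (nth [::] [:: [:: a00; a01; a02; a03]; [:: a10; a11; a12; a13];
                  [:: a20; a21; a22; a23]; [:: a30; a31; a32; a33]] i)`_j.

Ltac mx4_entries :=
  apply/matrixP => -[[|[|[|[|//]]]] ?] [[|[|[|[|//]]]] ?];
  rewrite !mxE ?big_ord_recl ?big_ord0 ?mxE /=.

Section Mx4.
Variable F : fieldType.
Local Notation mx4 := (@mx4 F).
Implicit Types a b c d : F.

Lemma mx4D
    a00 a01 a02 a03 a10 a11 a12 a13 a20 a21 a22 a23 a30 a31 a32 a33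
    b00 b01 b02 b03 b10 b11 b12 b13 b20 b21 b22 b23 b30 b31 b32 b33 :
  mx4 a00 a01 a02 a03 a10 a11 a12 a13 a20 a21 a22 a23 a30 a31 a32 a33 +
  mx4 b00 b01 b02 b03 b10 b11 b12 b13 b20 b21 b22 b23 b30 b31 b32 b33 =
  mx4 (a00 + b00) (a01 + b01) (a02 + b02) (a03 + b03)
      (a10 + b10) (a11 + b11) (a12 + b12) (a13 + b13)
      (a20 + b20) (a21 + b21) (a22 + b22) (a23 + b23)
      (a30 + b30) (a31 + b31) (a32 + b32) (a33 + b33).
Proof. by mx4_entries. Qed.

Lemma mx4Z c
    a00 a01 a02 a03 a10 a11 a12 a13 a20 a21 a22 a23 a30 a31 a32 a33 :
  c *: mx4 a00 a01 a02 a03 a10 a11 a12 a13 a20 a21 a22 a23 a30 a31 a32 a33 =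
  mx4 (c * a00) (c * a01) (c * a02) (c * a03)
      (c * a10) (c * a11) (c * a12) (c * a13)
      (c * a20) (c * a21) (c * a22) (c * a23)
      (c * a30) (c * a31) (c * a32) (c * a33).
Proof. by mx4_entries. Qed.

Lemma mx4N
    a00 a01 a02 a03 a10 a11 a12 a13 a20 a21 a22 a23 a30 a31 a32 a33 :
  - mx4 a00 a01 a02 a03 a10 a11 a12 a13 a20 a21 a22 a23 a30 a31 a32 a33 =
  mx4 (- a00) (- a01) (- a02) (- a03) (- a10) (- a11) (- a12) (- a13)
      (- a20) (- a21) (- a22) (- a23) (- a30) (- a31) (- a32) (- a33).
Proof. by mx4_entries. Qed.

Lemma mx4M
    a00 a01 a02 a03 a10 a11 a12 a13 a20 a21 a22 a23 a30 a31 a32 a33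
    b00 b01 b02 b03 b10 b11 b12 b13 b20 b21 b22 b23 b30 b31 b32 b33 :
  mx4 a00 a01 a02 a03 a10 a11 a12 a13 a20 a21 a22 a23 a30 a31 a32 a33 *m
  mx4 b00 b01 b02 b03 b10 b11 b12 b13 b20 b21 b22 b23 b30 b31 b32 b33 =
  mx4 (a00 * b00 + a01 * b10 + a02 * b20 + a03 * b30)
      (a00 * b01 + a01 * b11 + a02 * b21 + a03 * b31)
      (a00 * b02 + a01 * b12 + a02 * b22 + a03 * b32)
      (a00 * b03 + a01 * b13 + a02 * b23 + a03 * b33)
      (a10 * b00 + a11 * b10 + a12 * b20 + a13 * b30)
      (a10 * b01 + a11 * b11 + a12 * b21 + a13 * b31)
      (a10 * b02 + a11 * b12 + a12 * b22 + a13 * b32)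
      (a10 * b03 + a11 * b13 + a12 * b23 + a13 * b33)
      (a20 * b00 + a21 * b10 + a22 * b20 + a23 * b30)
      (a20 * b01 + a21 * b11 + a22 * b21 + a23 * b31)
      (a20 * b02 + a21 * b12 + a22 * b22 + a23 * b32)
      (a20 * b03 + a21 * b13 + a22 * b23 + a23 * b33)
      (a30 * b00 + a31 * b10 + a32 * b20 + a33 * b30)
      (a30 * b01 + a31 * b11 + a32 * b21 + a33 * b31)
      (a30 * b02 + a31 * b12 + a32 * b22 + a33 * b32)
      (a30 * b03 + a31 * b13 + a32 * b23 + a33 * b33).
Proof. by mx4_entries; rewrite addr0 !addrA. Qed.

Lemma mx4_tr
    a00 a01 a02 a03 a10 a11 a12 a13 a20 a21 a22 a23 a30 a31 a32 a33 :
  (mx4 a00 a01 a02 a03 a10 a11 a12 a13 a20 a21 a22 a23 a30 a31 a32 a33)^T =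
  mx4 a00 a10 a20 a30 a01 a11 a21 a31 a02 a12 a22 a32 a03 a13 a23 a33.
Proof. by mx4_entries. Qed.

Lemma mx4_0 : 0 = mx4 0 0 0 0 0 0 0 0 0 0 0 0 0 0 0 0.
Proof. by mx4_entries. Qed.

Lemma mx4_1 : 1%:M = mx4 1 0 0 0 0 1 0 0 0 0 1 0 0 0 0 1.
Proof. by mx4_entries. Qed.

Lemma sympJ_mx4 : sympJ F = mx4 0 0 1 0 0 0 0 1 (-1) 0 0 0 0 (-1) 0 0.
Proof. by []. Qed.

Lemma mx4_inj
    a00 a01 a02 a03 a10 a11 a12 a13 a20 a21 a22 a23 a30 a31 a32 a33
    b00 b01 b02 b03 b10 b11 b12 b13 b20 b21 b22 b23 b30 b31 b32 b33 :
  mx4 a00 a01 a02 a03 a10 a11 a12 a13 a20 a21 a22 a23 a30 a31 a32 a33 =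
  mx4 b00 b01 b02 b03 b10 b11 b12 b13 b20 b21 b22 b23 b30 b31 b32 b33 ->
  [/\ [/\ a00 = b00, a01 = b01, a02 = b02 & a03 = b03],
      [/\ a10 = b10, a11 = b11, a12 = b12 & a13 = b13],
      [/\ a20 = b20, a21 = b21, a22 = b22 & a23 = b23] &
      [/\ a30 = b30, a31 = b31, a32 = b32 & a33 = b33]].
Proof.
move/matrixP => eqM.
have e (i j : nat) (lti : (i < 4)%N) (ltj : (j < 4)%N) :=
  eqM (Ordinal lti) (Ordinal ltj).
split; split.
- by have := e 0%N 0%N isT isT; rewrite !mxE.
- by have := e 0%N 1%N isT isT; rewrite !mxE.
- by have := e 0%N 2%N isT isT; rewrite !mxE.
- by have := e 0%N 3%N isT isT; rewrite !mxE.
- by have := e 1%N 0%N isT isT; rewrite !mxE.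
- by have := e 1%N 1%N isT isT; rewrite !mxE.
- by have := e 1%N 2%N isT isT; rewrite !mxE.
- by have := e 1%N 3%N isT isT; rewrite !mxE.
- by have := e 2%N 0%N isT isT; rewrite !mxE.
- by have := e 2%N 1%N isT isT; rewrite !mxE.
- by have := e 2%N 2%N isT isT; rewrite !mxE.
- by have := e 2%N 3%N isT isT; rewrite !mxE.
- by have := e 3%N 0%N isT isT; rewrite !mxE.
- by have := e 3%N 1%N isT isT; rewrite !mxE.
- by have := e 3%N 2%N isT isT; rewrite !mxE.
- by have := e 3%N 3%N isT isT; rewrite !mxE.
Qed.

End Mx4.

(* T a b + p Xa + q Xb + r Xab + s Xa2b *)
Definition bor (F : fieldType) (a b p q r s : F) : 'M[F]_4 :=
  mx4 a q s r  0 b r p  0 0 (- a) 0  0 0 (- q) (- b).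

(** * Coordinates on the Borel subalgebra *)

Section Bor.
Variable F : fieldType.
Local Notation bor := (@bor F).
Implicit Types a b p q r s : F.

Lemma T_bor a b : T a b = bor a b 0 0 0 0.
Proof. by rewrite /bor; mx4_entries; rewrite ?oppr0. Qed.

Ltac E_entries :=
  rewrite /bor /E /=; mx4_entries; rewrite -!val_eqE /= !inordK //=;
  rewrite ?oppr0 ?subr0 ?addr0 ?add0r.

Lemma Xa_bor : Xa F = bor 0 0 1 0 0 0.
Proof. by rewrite /Xa; E_entries. Qed.
Lemma Xb_bor : Xb F = bor 0 0 0 1 0 0.
Proof. by rewrite /Xb; E_entries. Qed.
Lemma Xab_bor : Xab F = bor 0 0 0 0 1 0.
Proof. by rewrite /Xab; E_entries. Qed.
Lemma Xa2b_bor : Xa2b F = bor 0 0 0 0 0 1.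
Proof. by rewrite /Xa2b; E_entries. Qed.

Lemma borD a b p q r s a' b' p' q' r' s' :
  bor a b p q r s + bor a' b' p' q' r' s' =
  bor (a + a') (b + b') (p + p') (q + q') (r + r') (s + s').
Proof. by rewrite /bor mx4D; congr mx4; ring. Qed.

Lemma borZ c a b p q r s :
  c *: bor a b p q r s = bor (c * a) (c * b) (c * p) (c * q) (c * r) (c * s).
Proof. by rewrite /bor mx4Z; congr mx4; ring. Qed.

Lemma bor0 : 0 = bor 0 0 0 0 0 0.
Proof. by rewrite mx4_0 /bor oppr0. Qed.

Lemma bor_inj a b p q r s a' b' p' q' r' s' :
  bor a b p q r s = bor a' b' p' q' r' s' ->
  [/\ a = a', b = b' & [/\ p = p', q = q', r = r' & s = s']].
Proof. by rewrite /bor => /mx4_inj[[? ? ? ?] [_ ? _ ?] _ _]; split. Qed.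

(** The formula displays the root system: on [T a b] the roots alpha, beta, alpha+beta, alpha+2beta
    take the values 2b, a-b, a+b, 2a, and the other terms encode [[Xb, Xa] = Xab] and [[Xb, Xab] = 2
    Xa2b]. *)
Lemma lie_bor a b p q r s a' b' p' q' r' s' :
  lie (bor a b p q r s) (bor a' b' p' q' r' s') =
  bor 0 0 (2 * (b * p' - b' * p)) ((a - b) * q' - (a' - b') * q)
    ((a + b) * r' - (a' + b') * r + q * p' - q' * p)
    (2 * (a * s' - a' * s + q * r' - q' * r)).
Proof. by rewrite /lie /bor !mx4M mx4N mx4D; congr mx4; ring. Qed.

(** * Membership in spans and dimension counts *)

Lemma memv_span2 (X Y M : 'M[F]_4) :
  M \in <<[:: X; Y]>>%VS <-> exists x y, M = x *: X + y *: Y.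
Proof.
rewrite span_cons span_seq1; split=> [/memv_addP|[x [y ->]]].
  by case=> _ /vlineP[x ->] [_ /vlineP[y ->] ->]; exists x, y.
by apply: memv_add; rewrite memvZ ?memv_line.
Qed.

Lemma memv_span3 (X Y Z M : 'M[F]_4) :
  M \in <<[:: X; Y; Z]>>%VS <-> exists x y z, M = x *: X + y *: Y + z *: Z.
Proof.
rewrite span_cons; split=> [/memv_addP|[x [y [z ->]]]].
  case=> _ /vlineP[x ->] [_ /memv_span2[y [z ->]] ->].
  by exists x, y, z; rewrite addrA.
rewrite -addrA; apply: memv_add; first by rewrite memvZ ?memv_line.
by apply/memv_span2; exists y, z.
Qed.

Lemma memv_borel (M : 'M[F]_4) :
  M \in borel F <-> exists a b p q r s, M = bor a b p q r s.
Proof.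
split=> [/memv_addP|[a [b [p [q [r [s ->]]]]]]]; last first.
  have -> : bor a b p q r s =
      T a b + (p *: Xa F + (q *: Xb F + r *: Xab F + s *: Xa2b F)).
    rewrite T_bor Xa_bor Xb_bor Xab_bor Xa2b_bor !borZ !borD.
    by congr bor; ring.
  apply: memv_add; first by apply/torusP; exists a, b.
  rewrite span_cons; apply: memv_add; first by rewrite memvZ ?memv_line.
  by apply/memv_span3; exists q, r, s.
case=> X /torusP[a [b ->]] [Y].
rewrite span_cons => /memv_addP[_ /vlineP[p ->] [Z /memv_span3[q [r [s ->]]] ->]] ->.
exists a, b, p, q, r, s.
rewrite T_bor Xa_bor Xb_bor Xab_bor Xa2b_bor !borZ !borD.
by congr bor; ring.
Qed.

Lemma dim_span3 (X Y Z : 'M[F]_4) :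
  (forall x y z, x *: X + y *: Y + z *: Z = 0 -> [/\ x = 0, y = 0 & z = 0]) ->
  \dim <<[:: X; Y; Z]>> = 3%N.
Proof.
move=> indep; suff : free (in_tuple [:: X; Y; Z]) by move/eqP.
apply/freeP => k.
rewrite !big_ord_recl big_ord0 /= addr0 addrA => /indep[k0 k1 k2].
case=> -[|[|[|//]]] lti.
- by rewrite -[RHS]k0; congr k; apply: val_inj.
- by rewrite -[RHS]k1; congr k; apply: val_inj.
- by rewrite -[RHS]k2; congr k; apply: val_inj.
Qed.

Lemma span3_dim3 (S : {vspace 'M[F]_4}) (X Y Z : 'M[F]_4) :
  \dim S = 3%N -> \dim <<[:: X; Y; Z]>> = 3%N ->
  X \in S -> Y \in S -> Z \in S -> S = <<[:: X; Y; Z]>>%VS.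
Proof.
move=> dimS dimU XS YS ZS; apply/esym/eqP; rewrite eqEdim dimS dimU leqnn andbT.
apply/span_subvP => M; rewrite !inE => /orP[/eqP->|/orP[/eqP->|/eqP->]] //.
Qed.

Lemma notin_span2 (S : {vspace 'M[F]_4}) (X Y : 'M[F]_4) :
  \dim S = 3%N -> exists2 M, M \in S & M \notin <<[:: X; Y]>>%VS.
Proof.
move=> dimS; apply/subvPn; apply/negP => /dimvS; rewrite dimS => le3.
by have := leq_trans le3 (dim_span _).
Qed.

(** * The symplectic group and its action *)

Lemma sympJ_sqr : sympJ F *m sympJ F = - 1%:M.
Proof. by rewrite sympJ_mx4 mx4M mx4_1 mx4N; congr mx4; ring. Qed.

(** Invertibility comes for free: as J squares to -1, the relation makes -J g^t J a right inverse of
    g. *)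
Lemma Sp4_intro (g : 'M[F]_4) : g *m sympJ F *m g^T = sympJ F -> in_Sp4 g.
Proof.
move=> gJ; split=> //.
have: g *m (- (sympJ F *m g^T *m sympJ F)) = 1%:M.
  by rewrite mulmxN !mulmxA gJ sympJ_sqr opprK.
by case/mulmx1_unit.
Qed.

Lemma Sp4_unit (g : 'M[F]_4) : in_Sp4 g -> g \in unitmx.
Proof. by case. Qed.

Lemma Sp4_1 : in_Sp4 (1%:M : 'M[F]_4).
Proof. by apply: Sp4_intro; rewrite trmx1 mulmx1 mul1mx. Qed.

Lemma Sp4_mul (g h : 'M[F]_4) : in_Sp4 g -> in_Sp4 h -> in_Sp4 (g *m h).
Proof.
move=> [_ gJ] [_ hJ]; apply: Sp4_intro.
by rewrite trmx_mul !mulmxA -(mulmxA g h) -(mulmxA g) hJ gJ.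
Qed.

Lemma Sp4_inv (g : 'M[F]_4) : in_Sp4 g -> in_Sp4 (invmx g).
Proof.
move=> [gU gJ]; apply: Sp4_intro.
by rewrite -{1}gJ -!mulmxA -trmx_mul mulVmx // trmx1 mulmx1 mulKmx.
Qed.

(** Writing conjugation as an intertwining relation avoids [invmx], so that explicit conjugations
    become polynomial identities. *)
Lemma memv_conj (g : 'M[F]_4) (S : {vspace 'M[F]_4}) (M : 'M[F]_4) :
  g \in unitmx ->
  M \in conj_vspace g S <-> exists2 N, N \in S & g *m N = M *m g.
Proof.
move=> gU; split=> [/conj_vspaceP[N NS ->]|[N NS eqN]].
  by exists N; rewrite // mulmxKV.
by apply/conj_vspaceP; exists N; rewrite // eqN mulmxK.
Qed.

Lemma dim_conj (g : 'M[F]_4) (S : {vspace 'M[F]_4}) :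
  g \in unitmx -> \dim (conj_vspace g S) = \dim S.
Proof.
move=> gU; apply: limg_dim_eq; apply/eqP; rewrite -subv0.
apply/subvP => M; rewrite memv_cap memv_ker memv0 => /andP[_].
rewrite lfunE /= => /eqP gM0; apply/eqP.
by rewrite -[M](mulKmx gU) -[g *m M](mulmxKV gU) gM0 mul0mx mulmx0.
Qed.

Lemma conj_vspaceM (g h : 'M[F]_4) (S : {vspace 'M[F]_4}) :
  g \in unitmx -> h \in unitmx ->
  conj_vspace g (conj_vspace h S) = conj_vspace (g *m h) S.
Proof.
move=> gU hU; apply/vspaceP => M; apply/idP/idP.
  case/(memv_conj _ _ gU) => N /(memv_conj _ _ hU)[L LS eL] eN.
  apply/memv_conj; rewrite ?unitmx_mul ?gU //; exists L => //.
  by rewrite -mulmxA eL mulmxA eN mulmxA.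
case/memv_conj; rewrite ?unitmx_mul ?gU // => N NS eN.
apply/(memv_conj _ _ gU); exists (h *m N *m invmx h).
  by apply/(memv_conj _ _ hU); exists N; rewrite // mulmxKV.
by rewrite !mulmxA eN mulmxA mulmxK.
Qed.

Lemma conj_vspace1 (S : {vspace 'M[F]_4}) : conj_vspace 1%:M S = S.
Proof.
apply/vspaceP => M; apply/idP/idP => [/(memv_conj _ _ (unitmx1 _ _))|MS].
  by case=> N NS; rewrite mul1mx mulmx1 => <-.
by apply/memv_conj; rewrite ?unitmx1 //; exists M; rewrite // mul1mx mulmx1.
Qed.

Lemma sp4_equiv_refl (S : {vspace 'M[F]_4}) : sp4_equiv S S.
Proof. by exists 1%:M; [exact: Sp4_1 | exact: conj_vspace1]. Qed.

Lemma sp4_equiv_trans (S1 S2 S3 : {vspace 'M[F]_4}) :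
  sp4_equiv S1 S2 -> sp4_equiv S2 S3 -> sp4_equiv S1 S3.
Proof.
move=> [g gSp <-] [h hSp <-]; exists (h *m g); first exact: Sp4_mul.
by rewrite conj_vspaceM ?Sp4_unit.
Qed.

Lemma sp4_equiv_sym (S1 S2 : {vspace 'M[F]_4}) :
  sp4_equiv S1 S2 -> sp4_equiv S2 S1.
Proof.
move=> [g gSp <-]; exists (invmx g); first exact: Sp4_inv.
by rewrite conj_vspaceM ?Sp4_unit ?mulVmx ?conj_vspace1 ?Sp4_unit //; apply: Sp4_inv.
Qed.

Lemma lie_conj (g X Y X' Y' : 'M[F]_4) :
  g *m X = X' *m g -> g *m Y = Y' *m g -> g *m lie X Y = lie X' Y' *m g.
Proof.
move=> eX eY; rewrite /lie mulmxBr mulmxBl.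
by rewrite !mulmxA eX eY -!mulmxA eX eY.
Qed.

Lemma conj_lie_subalgebra (g : 'M[F]_4) (S : {vspace 'M[F]_4}) :
  g \in unitmx -> lie_subalgebra S -> lie_subalgebra (conj_vspace g S).
Proof.
move=> gU clS X Y /(memv_conj _ _ gU)[X1 X1S eX] /(memv_conj _ _ gU)[Y1 Y1S eY].
by apply/(memv_conj _ _ gU); exists (lie X1 Y1); [exact: clS | exact: lie_conj].
Qed.

(** By equality of dimensions, it is enough that the three generators be conjugates of elements of
    [S]. *)
Lemma sp4_equiv_span3 (g : 'M[F]_4) (S : {vspace 'M[F]_4}) (X Y Z : 'M[F]_4) :
  in_Sp4 g -> \dim S = 3%N -> \dim <<[:: X; Y; Z]>> = 3%N ->
  (exists2 N, N \in S & g *m N = X *m g) ->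
  (exists2 N, N \in S & g *m N = Y *m g) ->
  (exists2 N, N \in S & g *m N = Z *m g) ->
  sp4_equiv S <<[:: X; Y; Z]>>.
Proof.
move=> gSp dimS dimU XS YS ZS; exists g => //.
have gU := Sp4_unit gSp.
by apply: span3_dim3; rewrite ?dim_conj //; apply/memv_conj.
Qed.

(* The root subgroups of [beta] and [- beta], the unipotent radical of the
   Siegel parabolic, and representatives of two Weyl reflections. *)
Definition x_b (t : F) : 'M[F]_4 := mx4 1 t 0 0  0 1 0 0  0 0 1 0  0 0 (- t) 1.
Definition x_mb (t : F) : 'M[F]_4 := mx4 1 0 0 0  t 1 0 0  0 0 1 (- t)  0 0 0 1.
Definition n_S (p r s : F) : 'M[F]_4 := mx4 1 0 s r  0 1 r p  0 0 1 0  0 0 0 1.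
Definition w_b : 'M[F]_4 := mx4 0 1 0 0  1 0 0 0  0 0 0 1  0 0 1 0.
Definition w_a : 'M[F]_4 := mx4 1 0 0 0  0 0 0 1  0 0 1 0  0 (-1) 0 0.

Ltac Sp4_tac :=
  by apply: Sp4_intro; rewrite sympJ_mx4 mx4_tr !mx4M; congr mx4; ring.

Lemma x_b_Sp4 t : in_Sp4 (x_b t). Proof. Sp4_tac. Qed.
Lemma x_mb_Sp4 t : in_Sp4 (x_mb t). Proof. Sp4_tac. Qed.
Lemma n_S_Sp4 p r s : in_Sp4 (n_S p r s). Proof. Sp4_tac. Qed.
Lemma w_b_Sp4 : in_Sp4 w_b. Proof. Sp4_tac. Qed.
Lemma w_a_Sp4 : in_Sp4 w_a. Proof. Sp4_tac. Qed.

Lemma x_b_bor t a b p q r s :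
  x_b t *m bor a b p q r s =
  bor a b p (q + t * (b - a)) (r + t * p) (s + 2 * t * r + t ^+ 2 * p) *m x_b t.
Proof. by rewrite /bor !mx4M; congr mx4; ring. Qed.

Lemma n_S_bor p' r' s' a b p q r s :
  n_S p' r' s' *m bor a b p q r s =
  bor a b (p - 2 * b * p') q (r - (a + b) * r' - q * p')
    (s - 2 * (a * s' + q * r')) *m n_S p' r' s'.
Proof. by rewrite /bor !mx4M; congr mx4; ring. Qed.

(** This is the reflection in alpha, which exchanges beta and alpha+beta. It negates alpha, so the
    image stays in the Borel subalgebra only because the [Xa] coordinate is 0; likewise for beta in
    [w_b_bor]. *)
Lemma w_a_bor a b q r s :
  w_a *m bor a b 0 q r s = bor a (- b) 0 r (- q) s *m w_a.
Proof. by rewrite /bor !mx4M; congr mx4; ring. Qed.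

Lemma w_b_bor a b p r s :
  w_b *m bor a b p 0 r s = bor b a s 0 r p *m w_b.
Proof. by rewrite /bor !mx4M; congr mx4; ring. Qed.

(** On the symmetric matrix [[[s, r], [r, p]]] this is congruence by the lower unipotent matrix
    [[[1, 0], [t, 1]]]. *)
Lemma x_mb_bor t a p r s :
  x_mb t *m bor a a p 0 r s =
  bor a a (p + 2 * t * r + t ^+ 2 * s) 0 (r + t * s) s *m x_mb t.
Proof. by rewrite /bor !mx4M; congr mx4; ring. Qed.

(** In a basis of eigenvectors, the diagonal entries are roots of the characteristic polynomial,
    hence 1 or -1, and their squares are 1. *)
Lemma semisimple_sqr1 (X : 'M[F]_4) : semisimple X ->
  char_poly X = \prod_(c <- [:: 1; 1; -1; -1]) ('X - c%:P) -> X *m X = 1%:M.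
Proof.
move=> [P PU /diagonalizable_forPex[d /(simmxP PU) PX]] chX.
have d1 i : d 0 i * d 0 i = 1.
  have : eigenvalue X (d 0 i).
    apply/eigenvalueP; exists (row i P).
      by rewrite -row_mul PX row_mul row_diag_mx -scalemxAl -rowE.
    apply/negP => /eqP r0.
    have : row i 1%:M = 0 :> 'rV[F]_4 by rewrite -(mulmxV PU) row_mul r0 mul0mx.
    by move/rowP/(_ i); rewrite !mxE eqxx => /eqP; rewrite oner_eq0.
  rewrite eigenvalue_root_char chX root_prod_XsubC !inE.
  by move=> /or4P[]/eqP->; ring.
have dd : diag_mx d *m diag_mx d = 1%:M.
  rewrite mulmx_diag; apply/matrixP => i j; rewrite !mxE d1.
  by case: (i == j).
have : P *m (X *m X) = P by rewrite mulmxA PX -mulmxA PX mulmxA dd mul1mx.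
by move/(congr1 (mulmx (invmx P))); rewrite mulKmx ?mulVmx.
Qed.

End Bor.

(** * Subalgebras containing T_{1,1} or T_{1,-1} *)

Section Classification.
Variable F : numClosedFieldType.
Local Notation bor := (@bor F).
Implicit Types (S : {vspace 'M[F]_4}) (M N X Y Z : 'M[F]_4).
Implicit Types a b p q r s t : F.

(** The unprimed algebras are the chosen representatives of the four lines; [line1'] and [line3']
    are the other members of the first and third lines. *)
Definition line1 : {vspace 'M[F]_4} := <<[:: T 1 1; Xb F; Xa2b F]>>%VS.
Definition line2 : {vspace 'M[F]_4} := <<[:: T 1 (-1); Xa F; Xa2b F]>>%VS.
Definition line3 : {vspace 'M[F]_4} := <<[:: T 1 1; Xab F; Xa2b F]>>%VS.
Definition line4 : {vspace 'M[F]_4} := <<[:: T 1 1; Xa F; Xa2b F]>>%VS.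
Definition line1' : {vspace 'M[F]_4} := <<[:: T 1 (-1); Xab F; Xa2b F]>>%VS.
Definition line3' : {vspace 'M[F]_4} := <<[:: T 1 (-1); Xb F; Xa2b F]>>%VS.

Definition borE := (@T_bor F, @Xa_bor F, @Xb_bor F, @Xab_bor F, @Xa2b_bor F).

Ltac simp := rewrite ?(mulr0, mulr1, addr0, add0r, mulrN1, oppr0, mul0r, mulrN).

Ltac dim_tac :=
  apply: dim_span3 => x y z; rewrite !borE !borZ !borD bor0;
  case/bor_inj; simp => ? ? [? ? ? ?]; split.

Lemma dim_line1 : \dim line1 = 3%N. Proof. dim_tac=> //. Qed.
Lemma dim_line2 : \dim line2 = 3%N. Proof. dim_tac=> //. Qed.
Lemma dim_line3 : \dim line3 = 3%N. Proof. dim_tac=> //. Qed.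
Lemma dim_line4 : \dim line4 = 3%N. Proof. dim_tac=> //. Qed.
Lemma dim_line1' : \dim line1' = 3%N. Proof. dim_tac=> //. Qed.
Lemma dim_line3' : \dim line3' = 3%N. Proof. dim_tac=> //. Qed.

Lemma memv_line1 M : M \in line1 <-> exists x y z, M = bor x x 0 y 0 z.
Proof.
rewrite memv_span3; split=> -[x [y [z ->]]]; exists x, y, z;
  by rewrite !borE !borZ !borD; congr bor; ring.
Qed.

Lemma memv_line2 M : M \in line2 <-> exists x y z, M = bor x (- x) y 0 0 z.
Proof.
rewrite memv_span3; split=> -[x [y [z ->]]]; exists x, y, z;
  by rewrite !borE !borZ !borD; congr bor; ring.
Qed.

Lemma memv_line3 M : M \in line3 <-> exists x y z, M = bor x x 0 0 y z.
Proof.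
rewrite memv_span3; split=> -[x [y [z ->]]]; exists x, y, z;
  by rewrite !borE !borZ !borD; congr bor; ring.
Qed.

Lemma memv_line4 M : M \in line4 <-> exists x y z, M = bor x x y 0 0 z.
Proof.
rewrite memv_span3; split=> -[x [y [z ->]]]; exists x, y, z;
  by rewrite !borE !borZ !borD; congr bor; ring.
Qed.

Lemma memv_line1' M : M \in line1' <-> exists x y z, M = bor x (- x) 0 0 y z.
Proof.
rewrite memv_span3; split=> -[x [y [z ->]]]; exists x, y, z;
  by rewrite !borE !borZ !borD; congr bor; ring.
Qed.

Lemma memv_line3' M : M \in line3' <-> exists x y z, M = bor x (- x) 0 y 0 z.
Proof.
rewrite memv_span3; split=> -[x [y [z ->]]]; exists x, y, z;
  by rewrite !borE !borZ !borD; congr bor; ring.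
Qed.

Lemma line1'_equiv : sp4_equiv line1' line1.
Proof.
apply: (sp4_equiv_span3 (@w_a_Sp4 F) dim_line1' dim_line1).
- exists (bor 1 (-1) 0 0 0 0); first by apply/memv_line1'; exists 1, 0, 0.
  by rewrite T_bor w_a_bor; congr (_ *m _); congr bor; ring.
- exists (bor 0 0 0 0 1 0).
    by apply/memv_line1'; exists 0, 1, 0; congr bor; ring.
  by rewrite Xb_bor w_a_bor; congr (_ *m _); congr bor; ring.
- exists (bor 0 0 0 0 0 1).
    by apply/memv_line1'; exists 0, 0, 1; congr bor; ring.
  by rewrite Xa2b_bor w_a_bor; congr (_ *m _); congr bor; ring.
Qed.

Lemma line3'_equiv : sp4_equiv line3' line3.
Proof.
apply: (sp4_equiv_span3 (@w_a_Sp4 F) dim_line3' dim_line3).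
- exists (bor 1 (-1) 0 0 0 0); first by apply/memv_line3'; exists 1, 0, 0.
  by rewrite T_bor w_a_bor; congr (_ *m _); congr bor; ring.
(* The sign compensates for [w_a] carrying [Xb] to [- Xab]. *)
- exists (bor 0 0 0 (-1) 0 0).
    by apply/memv_line3'; exists 0, (-1), 0; congr bor; ring.
  by rewrite Xab_bor w_a_bor; congr (_ *m _); congr bor; ring.
- exists (bor 0 0 0 0 0 1).
    by apply/memv_line3'; exists 0, 0, 1; congr bor; ring.
  by rewrite Xa2b_bor w_a_bor; congr (_ *m _); congr bor; ring.
Qed.

(** No [Sp4]-conjugate of the standard torus lies in [S]: the only consequence of the absence of
    Cartan subalgebras that the classification uses, stated without inverses. *)
Definition torus_free S :=
  forall g : 'M[F]_4, in_Sp4 g ->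
  ~ (forall a b, exists2 N, N \in S & g *m N = T a b *m g).

Definition classified S :=
  [\/ sp4_equiv S line1, sp4_equiv S line2, sp4_equiv S line3
    | sp4_equiv S line4].

Lemma memv_borZ c S a b p q r s : c != 0 ->
  bor (c * a) (c * b) (c * p) (c * q) (c * r) (c * s) \in S ->
  bor a b p q r s \in S.
Proof.
move=> c0; rewrite -borZ => /(memvZ c^-1).
by rewrite scalerA mulVf // scale1r.
Qed.

(** If a and b differed, [x_b (q / (a - b))] would fix [T 1 1] and carry the other element to
    [T a b]; these two span the torus. *)
Lemma torus_free_plus S a b q : torus_free S ->
  bor 1 1 0 0 0 0 \in S -> bor a b 0 q 0 0 \in S -> a = b.
Proof.
move=> TF TS MS; apply/eqP/negPn/negP; rewrite -subr_eq0 => ab0.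
apply: (TF (x_b (q / (a - b)))); first exact: x_b_Sp4.
(* The coefficients express [T x y] in terms of [T 1 1] and [T a b] by Cramer's rule. *)
move=> x y; exists (((a * y - b * x) / (a - b)) *: bor 1 1 0 0 0 0 +
                     ((x - y) / (a - b)) *: bor a b 0 q 0 0).
  by rewrite rpredD // rpredZ.
rewrite !borZ borD x_b_bor T_bor; congr (_ *m _); congr bor; by field.
Qed.

(** Same argument with the root subgroup of alpha+beta, a root that vanishes on [T 1 (-1)]. *)
Lemma torus_free_minus S a b r : torus_free S ->
  bor 1 (-1) 0 0 0 0 \in S -> bor a b 0 0 r 0 \in S -> b = - a.
Proof.
move=> TF TS MS; apply/eqP/negPn/negP; rewrite -addr_eq0 addrC => ab0.
apply: (TF (n_S 0 (r / (a + b)) 0)); first exact: n_S_Sp4.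
move=> x y; exists (((x * b - y * a) / (a + b)) *: bor 1 (-1) 0 0 0 0 +
                     ((x + y) / (a + b)) *: bor a b 0 0 r 0).
  by rewrite rpredD // rpredZ.
rewrite !borZ borD n_S_bor T_bor; congr (_ *m _); congr bor; by field.
Qed.

(* The symmetric matrices [[s, r], [r, 1]] of rank one are those with
   r = t, s = t^2: over an algebraically closed field, the given plane of
   quadratic forms contains one of them. *)
Lemma rank_one_in_plane r1 s1 r s : (r != 0) || (s != 0) ->
  exists t c, r1 + c * r = t /\ s1 + c * s = t ^+ 2.
Proof.
case: (eqVneq r 0) => [-> /= s0|r0 _].
  by exists r1, ((r1 ^+ 2 - s1) / s); split; field.
(* Eliminating c leaves the quadratic equation t^2 - (s/r) t + (s r1/r - s1) = 0, solved by
   completing the square: t = k + w. *)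
pose k := s / r / 2; pose w := sqrtC (k ^+ 2 - (s * r1 / r - s1)).
have w2 : w ^+ 2 = k ^+ 2 - (s * r1 / r - s1) by rewrite sqrtCK.
exists (k + w), ((k + w - r1) / r); split; first by field.
rewrite sqrrD w2 /k; field; exact: r0.
Qed.

Lemma classified_conj (g : 'M[F]_4) S :
  in_Sp4 g -> classified (conj_vspace g S) -> classified S.
Proof.
move=> gSp; have SgS : sp4_equiv S (conj_vspace g S) by exists g.
case=> /(sp4_equiv_trans SgS) eqS; [exact: Or41 | exact: Or42 | exact: Or43 |].
exact: Or44.
Qed.

(** The plane of forms contains the degenerate form [Xa]. If its second generator is proportional to
    [Xab], this is the only degenerate line, and [S] is equivalent to [line3]; otherwise there is
    another one, which can be moved to [Xa2b], giving [line4]. *)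
Lemma classify_Xa_plane S r s : \dim S = 3%N ->
  bor 1 1 0 0 0 0 \in S -> bor 0 0 1 0 0 0 \in S ->
  bor 0 0 0 0 r s \in S -> (r != 0) || (s != 0) -> classified S.
Proof.
move=> dimS TS YS ZS; case: (eqVneq r 0) => [r0 /= s0|r0 _].
  subst r; have XS : bor 0 0 0 0 0 1 \in S.
    by apply: (@memv_borZ s); rewrite // !mulr0 mulr1.
  suff -> : S = line4 by apply/Or44/sp4_equiv_refl.
  by apply: (span3_dim3 dimS dim_line4); rewrite ?borE.
have XS : bor 0 0 0 0 1 (s / r) \in S.
  by apply: (@memv_borZ r); rewrite // mulrCA mulfV // !mulr0 !mulr1.
move: (s / r) XS => v XS {s ZS}; case: (eqVneq v 0) => [v0|v0].
  subst v; apply/Or43/(sp4_equiv_span3 (@w_b_Sp4 F) dimS dim_line3).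
  - by exists (bor 1 1 0 0 0 0); rewrite ?w_b_bor ?T_bor.
  - by exists (bor 0 0 0 0 1 0); rewrite ?w_b_bor ?Xab_bor.
  - by exists (bor 0 0 1 0 0 0); rewrite ?w_b_bor ?Xa2b_bor.
apply/Or44/(sp4_equiv_span3 (@x_mb_Sp4 F (- v^-1)) dimS dim_line4).
- exists (bor 1 1 0 0 0 0) => //.
  by rewrite T_bor x_mb_bor; congr (_ *m _); congr bor; ring.
- exists (bor 0 0 1 0 0 0) => //.
  by rewrite Xa_bor x_mb_bor; congr (_ *m _); congr bor; ring.
(* This is the second rank-one form of the plane, the square of the vector (1, 1/v), which
   [x_mb (- v^-1)] sends to (1, 0). *)
- exists (bor 0 0 (v ^- 2) 0 v^-1 1).
    have := rpredD (rpredZ v^-1 XS) (rpredZ (v ^- 2) YS); rewrite !borZ borD.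
    by congr (bor _ _ _ _ _ _ \in S); field.
  by rewrite Xa2b_bor x_mb_bor; congr (_ *m _); congr bor; field.
Qed.

Lemma classify_plus S : (S <= borel F)%VS -> lie_subalgebra S ->
  \dim S = 3%N -> torus_free S -> bor 1 1 0 0 0 0 \in S -> classified S.
Proof.
move=> /subvP SB clS dimS TF TS; have two0 : 2 != 0 :> F by rewrite pnatr_eq0.
(* [ad T_{1,1}] has eigenvalue 2 on [Xa], [Xab], [Xa2b] and 0 on [Xb] and the torus; halving the
   bracket with it projects to the first eigenspace. *)
have split2 a b p q r s : bor a b p q r s \in S ->
    a = b /\ bor 0 0 p 0 r s \in S /\ bor 0 0 0 q 0 0 \in S.
  move=> MS; have N2S : bor 0 0 p 0 r s \in S.
    apply: (memv_borZ two0); have := clS _ _ TS MS; rewrite lie_bor.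
    by congr (bor _ _ _ _ _ _ \in S); ring.
  have N0S : bor a b 0 q 0 0 \in S.
    have := rpredB MS N2S; rewrite -scaleN1r borZ borD.
    by congr (bor _ _ _ _ _ _ \in S); ring.
  have ab := torus_free_plus TF TS N0S; split=> //; split=> //.
  have := rpredB N0S (rpredZ a TS); rewrite -scaleN1r !borZ borD ab.
  by congr (bor _ _ _ _ _ _ \in S); ring.
case: (boolP (bor 0 0 0 1 0 0 \in S)) => [XbS|XbS].
  have [M MS Mn] := notin_span2 (bor 1 1 0 0 0 0) (bor 0 0 0 1 0 0) dimS.
  have [a [b [p [q [r [s eM]]]]]] := (memv_borel _).1 (SB _ MS).
  subst M; have [ab [NS _]] := split2 _ _ _ _ _ _ MS; subst b.
  suff XS : bor 0 0 0 0 0 1 \in S.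
    suff -> : S = line1 by apply/Or41/sp4_equiv_refl.
    by apply: (span3_dim3 dimS dim_line1); rewrite ?borE.
  (* [ad Xb] maps [Xa] to [Xab], then to a multiple of [Xa2b], then to 0: the last nonzero iterate
     on the third generator is a multiple of [Xa2b]. *)
  have := clS _ _ XbS NS; rewrite lie_bor => N1S.
  case: (eqVneq p 0) => [p0|p0]; last first.
    have two_p0 : 2 * p != 0 by rewrite mulf_neq0.
    apply: (memv_borZ two_p0); have := clS _ _ XbS N1S; rewrite lie_bor.
    by congr (bor _ _ _ _ _ _ \in S); ring.
  subst p; case: (eqVneq r 0) => [r0|r0]; last first.
    have two_r0 : 2 * r != 0 by rewrite mulf_neq0.
    apply: (memv_borZ two_r0); move: N1S.
    by congr (bor _ _ _ _ _ _ \in S); ring.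
  subst r; case: (eqVneq s 0) => [s0|s0]; last first.
    by apply: (memv_borZ s0); rewrite !mulr0 mulr1.
  subst s; case/negP: Mn; apply/memv_span2; exists a, q.
  by rewrite !borZ borD; congr bor; ring.
(* Now [Xb] is not in [S], which is therefore spanned by [T_{1,1}] and a plane of quadratic forms
   [[[s, r], [r, p]]]. *)
have split1 a b p q r s : bor a b p q r s \in S ->
    [/\ a = b, q = 0 & bor 0 0 p 0 r s \in S].
  case/split2=> ab [NS qS]; split=> //; apply/eqP/negPn/negP => q0.
  by case/negP: XbS; apply: (memv_borZ q0); rewrite !mulr0 mulr1.
case: (boolP (S <= line3)%VS) => [SU|/subvPn[M1 M1S M1n]].
  suff -> : S = line3 by apply/Or43/sp4_equiv_refl.
  by apply/eqP; rewrite eqEdim SU dimS dim_line3.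
have [a [b [p [q [r1 [s1 eM]]]]]] := (memv_borel _).1 (SB _ M1S).
subst M1; have [ab q0 N1S] := split1 _ _ _ _ _ _ M1S; subst b q.
have p0 : p != 0.
  by apply: contraNneq M1n => ->; apply/memv_line3; exists a, r1, s1.
have Y1S : bor 0 0 1 0 (r1 / p) (s1 / p) \in S.
  apply: (memv_borZ p0); move: N1S.
  by congr (bor _ _ _ _ _ _ \in S); field.
move: (r1 / p) (s1 / p) Y1S => {M1n M1S N1S r1 s1 a p p0}r1 s1 Y1S.
(* Subtracting a multiple of the normalized form from a third generator leaves a second form with p
   = 0. *)
have [M MS Mn] := notin_span2 (bor 1 1 0 0 0 0) (bor 0 0 1 0 r1 s1) dimS.
have [a [b [p [q [r2 [s2 eM]]]]]] := (memv_borel _).1 (SB _ MS).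
subst M; have [ab q0 N2S] := split1 _ _ _ _ _ _ MS; subst b q.
have Y2S : bor 0 0 0 0 (r2 - p * r1) (s2 - p * s1) \in S.
  have := rpredB N2S (rpredZ p Y1S); rewrite -scaleN1r !borZ borD.
  by congr (bor _ _ _ _ _ _ \in S); ring.
have rs0 : (r2 - p * r1 != 0) || (s2 - p * s1 != 0).
  rewrite -negb_and; apply: contra Mn; rewrite !subr_eq0.
  case/andP=> /eqP-> /eqP->; apply/memv_span2; exists a, p.
  by rewrite !borZ borD; congr bor; ring.
move: (r2 - p * r1) (s2 - p * s1) Y2S rs0 => r s Y2S rs0 {MS Mn N2S}.
have [t [c [et es]]] := rank_one_in_plane r1 s1 rs0.
have YS : bor 0 0 1 0 t (t ^+ 2) \in S.
  have := rpredD Y1S (rpredZ c Y2S); rewrite borZ borD -es -et.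
  by congr (bor _ _ _ _ _ _ \in S); ring.
(* The rank-one form is the square of the vector (t, 1), which [x_b (- t)] sends to (0, 1), that is,
   to [Xa]. *)
have gSp := @x_b_Sp4 F (- t); have gU := Sp4_unit gSp.
apply: (classified_conj gSp).
apply: (@classify_Xa_plane _ r (s - 2 * t * r)).
- by rewrite dim_conj.
- apply/(memv_conj _ _ gU); exists (bor 1 1 0 0 0 0) => //.
  by rewrite x_b_bor; congr (_ *m _); congr bor; ring.
- apply/(memv_conj _ _ gU); exists (bor 0 0 1 0 t (t ^+ 2)) => //.
  by rewrite x_b_bor; congr (_ *m _); congr bor; ring.
- apply/(memv_conj _ _ gU); exists (bor 0 0 0 0 r s) => //.
  by rewrite x_b_bor; congr (_ *m _); congr bor; ring.
- by case: (eqVneq r 0) rs0 => // -> /=; rewrite mulr0 subr0.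
Qed.

Lemma classify_minus S : (S <= borel F)%VS -> lie_subalgebra S ->
  \dim S = 3%N -> torus_free S -> bor 1 (-1) 0 0 0 0 \in S -> classified S.
Proof.
move=> /subvP SB clS dimS TF TS; have two0 : 2 != 0 :> F by rewrite pnatr_eq0.
(* [ad T_{1,-1}] has eigenvalue -2 on [Xa], 2 on [Xb] and [Xa2b], and 0 on [Xab] and the torus.
   Applying half of it once and twice and combining the results separates the three eigenspaces. *)
have split3 a b p q r s : bor a b p q r s \in S ->
    [/\ b = - a, bor 0 0 p 0 0 0 \in S, bor 0 0 0 q 0 s \in S &
        bor 0 0 0 0 r 0 \in S].
  move=> MS; have N1S : bor 0 0 (- p) q 0 s \in S.
    apply: (memv_borZ two0); have := clS _ _ TS MS; rewrite lie_bor.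
    by congr (bor _ _ _ _ _ _ \in S); ring.
  have N2S : bor 0 0 p q 0 s \in S.
    apply: (memv_borZ two0); have := clS _ _ TS N1S; rewrite lie_bor.
    by congr (bor _ _ _ _ _ _ \in S); ring.
  have N0S : bor a b 0 0 r 0 \in S.
    have := rpredB MS N2S; rewrite -scaleN1r borZ borD.
    by congr (bor _ _ _ _ _ _ \in S); ring.
  have ab := torus_free_minus TF TS N0S; split=> //.
  - apply: (memv_borZ two0); have := rpredB N2S N1S.
    rewrite -scaleN1r borZ borD.
    by congr (bor _ _ _ _ _ _ \in S); ring.
  - apply: (memv_borZ two0); have := rpredD N2S N1S; rewrite borD.
    by congr (bor _ _ _ _ _ _ \in S); ring.
  - have := rpredB N0S (rpredZ a TS); rewrite -scaleN1r !borZ borD ab.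
    by congr (bor _ _ _ _ _ _ \in S); ring.
case: (boolP (bor 0 0 0 0 1 0 \in S)) => [XabS|XabS].
  have [M MS Mn] := notin_span2 (bor 1 (-1) 0 0 0 0) (bor 0 0 0 0 1 0) dimS.
  have [a [b [p [q [r [s eM]]]]]] := (memv_borel _).1 (SB _ MS).
  subst M; have [ab pS qS _] := split3 _ _ _ _ _ _ MS; subst b.
  case: (eqVneq p 0) => [p0|p0]; last first.
    have XaS : bor 0 0 1 0 0 0 \in S.
      by apply: (memv_borZ p0); rewrite !mulr0 mulr1.
    apply/Or41/(sp4_equiv_trans _ line1'_equiv).
    apply: (sp4_equiv_span3 (@w_b_Sp4 F) dimS dim_line1').
    (* [w_b] exchanges the two torus entries, so [T_{1,-1}] is the image of its opposite. *)
    - exists (bor (-1) 1 0 0 0 0); last by rewrite w_b_bor T_bor.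
      have := rpredZ (-1) TS; rewrite borZ.
      by congr (bor _ _ _ _ _ _ \in S); ring.
    - by exists (bor 0 0 0 0 1 0); rewrite ?w_b_bor ?Xab_bor.
    - by exists (bor 0 0 1 0 0 0); rewrite ?w_b_bor ?Xa2b_bor.
  subst p; suff XS : bor 0 0 0 0 0 1 \in S.
    suff -> : S = line1' by apply/Or41/line1'_equiv.
    by apply: (span3_dim3 dimS dim_line1'); rewrite ?borE.
  case: (eqVneq q 0) => [q0|q0]; last first.
    have c0 : - 2 * q != 0 by rewrite mulf_neq0 // oppr_eq0.
    apply: (memv_borZ c0); have := clS _ _ XabS qS; rewrite lie_bor.
    by congr (bor _ _ _ _ _ _ \in S); ring.
  subst q; case: (eqVneq s 0) => [s0|s0]; last first.
    by apply: (memv_borZ s0); rewrite !mulr0 mulr1.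
  subst s; case/negP: Mn; apply/memv_span2; exists a, r.
  by rewrite !borZ borD; congr bor; ring.
have r_eq0 r : bor 0 0 0 0 r 0 \in S -> r = 0.
  move=> rS; apply/eqP/negPn/negP => r0; case/negP: XabS.
  by apply: (memv_borZ r0); rewrite !mulr0 mulr1.
case: (boolP (bor 0 0 1 0 0 0 \in S)) => [XaS|XaS].
  have [M MS Mn] := notin_span2 (bor 1 (-1) 0 0 0 0) (bor 0 0 1 0 0 0) dimS.
  have [a [b [p [q [r [s eM]]]]]] := (memv_borel _).1 (SB _ MS).
  subst M; have [ab pS qS /r_eq0 r0] := split3 _ _ _ _ _ _ MS; subst b r.
  (* Bracketing with [Xa] turns [q Xb + s Xa2b] into [- q Xab], and no nonzero multiple of [Xab]
     lies in [S]. *)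
  have q0 : q = 0.
    apply/eqP; rewrite -oppr_eq0; apply/eqP/r_eq0.
    have := clS _ _ XaS qS; rewrite lie_bor => {}/split3[_ _ _].
    by congr (bor _ _ _ _ _ _ \in S); ring.
  subst q; suff XS : bor 0 0 0 0 0 1 \in S.
    suff -> : S = line2 by apply/Or42/sp4_equiv_refl.
    by apply: (span3_dim3 dimS dim_line2); rewrite ?borE.
  case: (eqVneq s 0) => [s0|s0]; last first.
    by apply: (memv_borZ s0); rewrite !mulr0 mulr1.
  subst s; case/negP: Mn; apply/memv_span2; exists a, p.
  by rewrite !borZ borD; congr bor; ring.
(* With neither [Xa] nor [Xab] in [S], only [T_{1,-1}], [Xb] and [Xa2b] can contribute. *)
suff -> : S = line3' by apply/Or43/line3'_equiv.
apply/eqP; rewrite eqEdim dimS dim_line3' andbT; apply/subvP => M MS.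
have [a [b [p [q [r [s eM]]]]]] := (memv_borel _).1 (SB _ MS).
subst M; have [ab pS qS /r_eq0 r0] := split3 _ _ _ _ _ _ MS; subst b r.
have p0 : p = 0.
  apply/eqP/negPn/negP => p0; case/negP: XaS.
  by apply: (memv_borZ p0); rewrite !mulr0 mulr1.
by subst p; apply/memv_line3'; exists a, q, s.
Qed.

End Classification.

(** * Reduction to T_{1,1} and T_{1,-1} *)

Section Reduction.
Variable F : numClosedFieldType.
Local Notation bor := (@bor F).
Implicit Types (S : {vspace 'M[F]_4}) (M N X Y Z : 'M[F]_4).

Lemma conj_borel (g : 'M[F]_4) S :
  g \in unitmx ->
  (forall a b p q r s, exists2 M, M \in borel F & g *m bor a b p q r s = M *m g) ->
  (S <= borel F)%VS -> (conj_vspace g S <= borel F)%VS.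
Proof.
move=> gU gB /subvP SB; apply/subvP => M /(memv_conj _ _ gU)[N /SB].
move=> /memv_borel[a [b [p [q [r [s ->]]]]]].
have [M' M'B ->] := gB a b p q r s.
by move=> /(congr1 (mulmx^~ (invmx g))); rewrite !mulmxK // => <-.
Qed.

Lemma x_b_borel t S :
  (S <= borel F)%VS -> (conj_vspace (x_b t) S <= borel F)%VS.
Proof.
apply: conj_borel; first exact/Sp4_unit/x_b_Sp4.
move=> a b p q r s; eexists; last exact: x_b_bor.
by apply/memv_borel; do 6!eexists.
Qed.

Lemma n_S_borel p' r' s' S :
  (S <= borel F)%VS -> (conj_vspace (n_S p' r' s') S <= borel F)%VS.
Proof.
apply: conj_borel; first exact/Sp4_unit/n_S_Sp4.
move=> a b p q r s; eexists; last exact: n_S_bor.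
by apply/memv_borel; do 6!eexists.
Qed.

(** * Conjugates of the torus as Cartan subalgebras *)

Lemma dim_torus : \dim (torus F) = 2%N.
Proof.
suff /eqP : free (in_tuple [:: T 1 0; T 0 1 : 'M[F]_4]) by [].
apply/freeP => k; rewrite !big_ord_recl big_ord0 /= addr0 !T_bor !borZ borD bor0.
case/bor_inj; rewrite !mulr1 !mulr0 addr0 add0r => k0 k1 _.
case=> -[|[|//]] lti.
- by rewrite -[RHS]k0; congr k; apply: val_inj.
- by rewrite -[RHS]k1; congr k; apply: val_inj.
Qed.

Lemma sp4_T a b : in_sp4 (T a b : 'M[F]_4).
Proof.
by rewrite /in_sp4 T_bor sympJ_mx4 /bor mx4_tr !mx4M; congr mx4; ring.
Qed.

Lemma in_sp4_conj (g X : 'M[F]_4) :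
  in_Sp4 g -> in_sp4 X -> in_sp4 (g *m X *m invmx g).
Proof.
move=> [gU gJ] XJ; rewrite /in_sp4 !trmx_mul.
have gJ1 : sympJ F *m (invmx g)^T = g *m sympJ F.
  by rewrite -{1}gJ -mulmxA -trmx_mul mulVmx // trmx1 mulmx1.
have gJ2 : g^T *m sympJ F = sympJ F *m invmx g.
  (* Up to sign J g and J g^t are mutually inverse, hence commute; this gives the transposed
     relation g^t J g = J. *)
  have : sympJ F *m g *m (sympJ F *m g^T) = - 1%:M.
    by rewrite -mulmxA (mulmxA g) gJ sympJ_sqr.
  move/(congr1 (fun M => - M)); rewrite opprK -mulNmx => /mulmx1C.
  rewrite mulmxN => /(congr1 (fun M => - M)); rewrite opprK => e.
  have := congr1 (mulmx (sympJ F)) (congr1 (mulmx^~ (invmx g)) e).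
  rewrite !mulmxA mulmxK // sympJ_sqr -!mulmxA.
  by rewrite !mulNmx !mul1mx mulmxN => /oppr_inj.
rewrite -{2}XJ !mulmxA gJ1 -(mulmxA _ g^T) gJ2.
by rewrite !mulmxA.
Qed.

Lemma cartan_conj_torus (g : 'M[F]_4) :
  in_Sp4 g -> cartan_subalgebra (conj_vspace g (torus F)).
Proof.
move=> gSp; have gU := Sp4_unit gSp.
have abel X Y : X \in conj_vspace g (torus F) ->
    Y \in conj_vspace g (torus F) -> lie X Y = 0.
  move=> /(memv_conj _ _ gU)[_ /torusP[a [b ->]] eX].
  move=> /(memv_conj _ _ gU)[_ /torusP[c [d ->]] eY].
  have := lie_conj eX eY; rewrite !T_bor lie_bor.
  have -> : bor 0 0 (2 * (b * 0 - d * 0)) ((a - b) * 0 - (c - d) * 0)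
      ((a + b) * 0 - (c + d) * 0 + 0 * 0 - 0 * 0)
      (2 * (a * 0 - c * 0 + 0 * 0 - 0 * 0)) = 0.
    by rewrite bor0; congr bor; ring.
  rewrite mulmx0 => /(congr1 (mulmx^~ (invmx g))).
  by rewrite mulmxK // mul0mx.
split=> //.
- by rewrite dim_conj // dim_torus.
- by move=> X Y XS YS; rewrite abel // mem0v.
move=> X /conj_vspaceP[_ /torusP[a [b ->]] ->]; split.
  exact/in_sp4_conj/sp4_T.
exists (invmx g); first by rewrite unitmx_inv.
apply/diagonalizable_forPex; eexists; apply/simmxP; first by rewrite unitmx_inv.
by rewrite !mulmxA mulVmx // mul1mx.
Qed.

Lemma torus_free_cartan S :
  ~ (exists2 H : {vspace 'M[F]_4}, cartan_subalgebra H & (H <= S)%VS) ->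
  torus_free S.
Proof.
move=> noH g gSp TS; apply: noH; have gU := Sp4_unit gSp.
exists (conj_vspace (invmx g) (torus F)).
  exact/cartan_conj_torus/Sp4_inv.
apply/subvP => M /conj_vspaceP[_ /torusP[a [b ->]] ->]; rewrite invmxK.
have [N NS eN] := TS a b.
by rewrite -mulmxA -eN mulKmx.
Qed.

Lemma torus_free_conj (g : 'M[F]_4) S :
  in_Sp4 g -> torus_free S -> torus_free (conj_vspace g S).
Proof.
move=> gSp TF h hSp TS; apply: (TF (h *m g)); first exact: Sp4_mul.
move=> a b; have [N /(memv_conj _ _ (Sp4_unit gSp))[L LS eL] eN] := TS a b.
by exists L; rewrite // -mulmxA eL mulmxA eN mulmxA.
Qed.

(** Squaring X gives a^2 = b^2 = 1 together with (a+b)q = 0 and (a-b)r + qp = 0, which let a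
    unipotent element bring X to [T a b]. *)
Lemma classify S X : (S <= borel F)%VS -> lie_subalgebra S ->
  \dim S = 3%N -> torus_free S -> X \in S -> X *m X = 1%:M -> classified S.
Proof.
move=> SB clS dimS TF XS.
have [a [b [p [q [r [s eX]]]]]] := (memv_borel _).1 (subvP SB _ XS).
rewrite {}eX in XS *; rewrite {1 2}/bor mx4M mx4_1.
move=> /mx4_inj[[a2 qab _ rpq] [_ b2 _ _] _ _].
have {}a2 : a ^+ 2 = 1 by rewrite -a2; ring.
have {}b2 : b ^+ 2 = 1 by rewrite -b2; ring.
have {}qab : (a + b) * q = 0 by rewrite -qab; ring.
have {}rpq : (a - b) * r + q * p = 0 by rewrite -rpq; ring.
have two0 : 2 != 0 :> F by rewrite pnatr_eq0.
(* If b = -a, then (a-b)^2 = 4 and this is q/(a-b), the value cancelling q; if b = a, both t and q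
   are 0. The parameters of [n_S] then cancel p, r1 and s1; when b = -a, r1 is already 0. *)
pose t := (a - b) * q / 4.
pose s1 := s + 2 * t * r + t ^+ 2 * p; pose r1 := r + t * p.
pose g := n_S (b * p / 2) (a * r1 / 2) (a * s1 / 2) *m x_b t.
have gSp : in_Sp4 g by apply: Sp4_mul; [exact: n_S_Sp4 | exact: x_b_Sp4].
have gU := Sp4_unit gSp; apply: (classified_conj gSp).
have gX : g *m bor a b p q r s = bor a b 0 0 0 0 *m g.
  rewrite /g -mulmxA x_b_bor !mulmxA n_S_bor; congr (_ *m _ *m _).
  move: a2 b2 qab rpq; rewrite /s1 /r1 /t => /eqP; rewrite sqrf_eq1.
  case/orP=> /eqP-> /eqP; rewrite sqrf_eq1 => /orP[]/eqP-> qab rpq.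
  - have -> : q = 0.
      by transitivity (2^-1 * ((1 + 1) * q)); [field | rewrite qab mulr0].
    by congr bor; field.
  - have -> : r = - (q * p / 2).
      apply/eqP; rewrite -subr_eq0; apply/eqP.
      by transitivity (2^-1 * ((1 - -1) * r + q * p)); [field | rewrite rpq mulr0].
    by congr bor; field.
  - have -> : r = q * p / 2.
      apply/eqP; rewrite -subr_eq0; apply/eqP.
      by transitivity (- 2^-1 * ((-1 - 1) * r + q * p)); [field | rewrite rpq mulr0].
    by congr bor; field.
  - have -> : q = 0.
      by transitivity (- 2^-1 * ((-1 - 1) * q)); [field | rewrite qab mulr0].
    by congr bor; field.
have S'B : (conj_vspace g S <= borel F)%VS.
  by rewrite -conj_vspaceM ?Sp4_unit ?n_S_borel ?x_b_borel //;
    [exact: n_S_Sp4 | exact: x_b_Sp4].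
have clS' := conj_lie_subalgebra gU clS.
have dimS' : \dim (conj_vspace g S) = 3%N by rewrite dim_conj.
have TF' := torus_free_conj gSp TF.
have TS' : bor a b 0 0 0 0 \in conj_vspace g S.
  by apply/(memv_conj _ _ gU); exists (bor a b p q r s).
have TS'N : bor (- a) (- b) 0 0 0 0 \in conj_vspace g S.
  by have := rpredZ (-1) TS'; rewrite borZ !mulr0 !mulN1r.
move: a2 b2 TS' TS'N => /eqP + /eqP; rewrite !sqrf_eq1.
by case/orP=> /eqP-> /orP[]/eqP->; rewrite ?opprK => T1 T2;
  first [exact: classify_plus | exact: classify_minus].
Qed.

(** * Invariants *)

Definition has_center S :=
  exists Z, [/\ Z \in S, Z != 0 & forall X, X \in S -> lie X Z = 0].

Definition has_opposite_weights S :=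
  exists X Y Z, [/\ X \in S, Y \in S & Z \in S] /\
    [/\ Y != 0, Z != 0, lie X Y = Y & lie X Z = - Z].

(** As a factorization, rank at most one passes to a conjugate by acting on u and v separately. *)
Definition rank_le1 Y := exists (u : 'cV[F]_4) (v : 'rV[F]_4), Y = u *m v.

Definition rank_le1_not_closed S :=
  exists Y Z, [/\ Y \in S, Z \in S, rank_le1 Y, rank_le1 Z & ~ rank_le1 (Y + Z)].

(** Common transport step for the three invariants. *)
Lemma conj_witness (g : 'M[F]_4) S M : g \in unitmx -> M \in S ->
  exists M', [/\ M' \in conj_vspace g S, g *m M = M' *m g,
    (M' == 0) = (M == 0) & rank_le1 M <-> rank_le1 M'].
Proof.
move=> gU MS; exists (g *m M *m invmx g); split.
- by apply/conj_vspaceP; exists M.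
- by rewrite mulmxKV.
- apply/eqP/eqP => [e|->]; last by rewrite mulmx0 mul0mx.
  by rewrite -[M](mulKmx gU) -[g *m M](mulmxKV gU) e mul0mx mulmx0.
- split=> [[u [v ->]]|[u [v e]]].
    by exists (g *m u), (v *m invmx g); rewrite !mulmxA.
  exists (invmx g *m u), (v *m g).
  by rewrite mulmxA -(mulmxA _ u) -e -mulmxA mulmxKV // mulKmx.
Qed.

Lemma has_center_equiv S S' : sp4_equiv S S' -> has_center S -> has_center S'.
Proof.
move=> [g /Sp4_unit gU <-] [Z [ZS Z0 cZ]].
have [Z' [Z'S eZ eZ0 _]] := conj_witness gU ZS.
exists Z'; split=> //; first by rewrite eZ0.
move=> X' /(memv_conj _ _ gU)[X XS eX].
have := lie_conj eX eZ; rewrite cZ // mulmx0.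
by move/(congr1 (mulmx^~ (invmx g))); rewrite mulmxK // mul0mx.
Qed.

Lemma has_opposite_weights_equiv S S' :
  sp4_equiv S S' -> has_opposite_weights S -> has_opposite_weights S'.
Proof.
move=> [g /Sp4_unit gU <-] [X [Y [Z [[XS YS ZS] [Y0 Z0 eXY eXZ]]]]].
have [X' [X'S eX _ _]] := conj_witness gU XS.
have [Y' [Y'S eY eY0 _]] := conj_witness gU YS.
have [Z' [Z'S eZ eZ0 _]] := conj_witness gU ZS.
exists X', Y', Z'; split=> //; split; rewrite ?eY0 ?eZ0 //.
  have := lie_conj eX eY; rewrite eXY eY.
  by move/(congr1 (mulmx^~ (invmx g))); rewrite !mulmxK.
have := lie_conj eX eZ; rewrite eXZ mulmxN eZ -mulNmx.
by move/(congr1 (mulmx^~ (invmx g))); rewrite !mulmxK.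
Qed.

Lemma rank_le1_not_closed_equiv S S' :
  sp4_equiv S S' -> rank_le1_not_closed S -> rank_le1_not_closed S'.
Proof.
move=> [g /Sp4_unit gU <-] [Y [Z [YS ZS rY rZ rYZ]]].
have [Y' [Y'S eY _ eYr]] := conj_witness gU YS.
have [Z' [Z'S eZ _ eZr]] := conj_witness gU ZS.
exists Y', Z'; split=> //; [exact/eYr | exact/eZr |].
have [W [_ eW _ eWr]] := conj_witness gU (rpredD YS ZS).
suff -> : Y' + Z' = W by move/eWr.
move: eW; rewrite mulmxDr eY eZ -mulmxDl.
by move/(congr1 (mulmx^~ (invmx g))); rewrite !mulmxK.
Qed.

Lemma bor_neq0 p q s : [|| p != 0, q != 0 | s != 0] -> bor 0 0 p q 0 s != 0.
Proof.
apply: contraTneq; rewrite bor0 => /bor_inj[_ _ [-> -> _ ->]].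
by rewrite eqxx.
Qed.

(** * Values of the invariants on the four lines *)

Lemma line1_center : has_center (line1 F).
Proof.
(* [Xb] is central: beta vanishes on [T_{1,1}], and alpha+3beta is not a root. *)
exists (bor 0 0 0 1 0 0); split.
- by apply/memv_line1; exists 0, 1, 0.
- by rewrite bor_neq0 ?oner_eq0 ?orbT.
move=> _ /memv_line1[x [y [z ->]]].
by rewrite lie_bor bor0; congr bor; ring.
Qed.

Let mul2_eq0 (x : F) : 2 * x = 0 -> x = 0.
Proof. by move/eqP; rewrite mulf_eq0 pnatr_eq0 => /eqP. Qed.

(** The roots present are nonzero on the torus generator, which kills the root components of a
    central element; the bracket with [Xa2b] kills the torus component. The next two lemmas argue
    alike. *)
Lemma line2_no_center : ~ has_center (line2 F).
Proof.
case=> Z [/memv_line2[x [y [z ->]]] /eqP Z0 cZ]; apply: Z0.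
have TS : bor 1 (-1) 0 0 0 0 \in line2 F by apply/memv_line2; exists 1, 0, 0.
have XS : bor 0 0 0 0 0 1 \in line2 F.
  by apply/memv_line2; exists 0, 0, 1; rewrite oppr0.
have := cZ _ TS; rewrite lie_bor bor0 => /bor_inj[_ _ [y0 _ _ z0]].
have := cZ _ XS; rewrite lie_bor bor0 => /bor_inj[_ _ [_ _ _ x0]].
have -> : x = 0 by apply/mul2_eq0; rewrite -[RHS]oppr0 -[in RHS]x0; ring.
have -> : y = 0 by apply/mul2_eq0; rewrite -[RHS]oppr0 -[in RHS]y0; ring.
have -> : z = 0 by apply/mul2_eq0; rewrite -[RHS]z0; ring.
by rewrite oppr0.
Qed.

Lemma line3_no_center : ~ has_center (line3 F).
Proof.
case=> Z [/memv_line3[x [y [z ->]]] /eqP Z0 cZ]; apply: Z0.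
have TS : bor 1 1 0 0 0 0 \in line3 F by apply/memv_line3; exists 1, 0, 0.
have XS : bor 0 0 0 0 0 1 \in line3 F by apply/memv_line3; exists 0, 0, 1.
have := cZ _ TS; rewrite lie_bor bor0 => /bor_inj[_ _ [_ _ y0 z0]].
have := cZ _ XS; rewrite lie_bor bor0 => /bor_inj[_ _ [_ _ _ x0]].
have -> : x = 0 by apply/mul2_eq0; rewrite -[RHS]oppr0 -[in RHS]x0; ring.
have -> : y = 0 by apply/mul2_eq0; rewrite -[RHS]y0; ring.
by have -> : z = 0 by apply/mul2_eq0; rewrite -[RHS]z0; ring.
Qed.

Lemma line4_no_center : ~ has_center (line4 F).
Proof.
case=> Z [/memv_line4[x [y [z ->]]] /eqP Z0 cZ]; apply: Z0.
have TS : bor 1 1 0 0 0 0 \in line4 F by apply/memv_line4; exists 1, 0, 0.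
have XS : bor 0 0 0 0 0 1 \in line4 F by apply/memv_line4; exists 0, 0, 1.
have := cZ _ TS; rewrite lie_bor bor0 => /bor_inj[_ _ [y0 _ _ z0]].
have := cZ _ XS; rewrite lie_bor bor0 => /bor_inj[_ _ [_ _ _ x0]].
have -> : x = 0 by apply/mul2_eq0; rewrite -[RHS]oppr0 -[in RHS]x0; ring.
have -> : y = 0 by apply/mul2_eq0; rewrite -[RHS]y0; ring.
by have -> : z = 0 by apply/mul2_eq0; rewrite -[RHS]z0; ring.
Qed.

Lemma line2_opposite_weights : has_opposite_weights (line2 F).
Proof.
(* Halving [T_{1,-1}] scales its weights 2 on [Xa2b] and -2 on [Xa] to 1 and -1. *)
exists (bor 2^-1 (- 2^-1) 0 0 0 0), (bor 0 0 0 0 0 1), (bor 0 0 1 0 0 0).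
split; split.
- by apply/memv_line2; exists 2^-1, 0, 0.
- by apply/memv_line2; exists 0, 0, 1; rewrite oppr0.
- by apply/memv_line2; exists 0, 1, 0; rewrite oppr0.
- by rewrite bor_neq0 ?oner_eq0 ?orbT.
- by rewrite bor_neq0 ?oner_eq0 ?orbT.
- by rewrite lie_bor; congr bor; field.
- by rewrite lie_bor -scaleN1r borZ; congr bor; field.
Qed.

(* If [lie X Y = Y <> 0] then [X] has torus part [T (1/2) (1/2)], and
   [lie X Z = - Z <> 0] forces the opposite torus part. *)
Lemma no_opposite_weights S :
  (forall M, M \in S -> exists x p r s, M = bor x x p 0 r s) ->
  ~ has_opposite_weights S.
Proof.
move=> SE [X [Y [Z [[/SE[x [p [r [s ->]]]] /SE[y [p1 [r1 [s1 ->]]]]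
  /SE[z [p2 [r2 [s2 ->]]]]] [/eqP Y0 /eqP Z0]]]]].
rewrite -scaleN1r borZ !lie_bor.
move=> /bor_inj[y0 _ [ep1 _ er1 es1]] /bor_inj[z0 _ [ep2 _ er2 es2]].
have {}z0 : z = 0 by apply/eqP; rewrite -oppr_eq0 -mulN1r -z0.
subst y z.
case: (eqVneq (2 * x) 1) => [x1|x1].
  apply: Z0; rewrite bor0; congr bor; apply/mul2_eq0.
  - transitivity ((2 * x) * p2 + p2); first by rewrite x1; ring.
    by rewrite -[RHS](addNr p2) -[in RHS]mulN1r -ep2; ring.
  - transitivity ((2 * x) * r2 + r2); first by rewrite x1; ring.
    by rewrite -[RHS](addNr r2) -[in RHS]mulN1r -er2; ring.
  - transitivity ((2 * x) * s2 + s2); first by rewrite x1; ring.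
    by rewrite -[RHS](addNr s2) -[in RHS]mulN1r -es2; ring.
apply: Y0; rewrite bor0; congr bor; apply/eqP.
- have : (2 * x - 1) * p1 == 0.
    by apply/eqP; rewrite -[RHS](subrr p1) -{2}ep1; ring.
  by rewrite mulf_eq0 subr_eq0 (negPf x1).
- have : (2 * x - 1) * r1 == 0.
    by apply/eqP; rewrite -[RHS](subrr r1) -{2}er1; ring.
  by rewrite mulf_eq0 subr_eq0 (negPf x1).
- have : (2 * x - 1) * s1 == 0.
    by apply/eqP; rewrite -[RHS](subrr s1) -{2}es1; ring.
  by rewrite mulf_eq0 subr_eq0 (negPf x1).
Qed.

Lemma line3_no_opposite_weights : ~ has_opposite_weights (line3 F).
Proof.
apply: no_opposite_weights => M /memv_line3[x [y [z ->]]].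
by exists x, 0, y, z.
Qed.

Lemma line4_no_opposite_weights : ~ has_opposite_weights (line4 F).
Proof.
apply: no_opposite_weights => M /memv_line4[x [y [z ->]]].
by exists x, y, 0, z.
Qed.

Lemma rank_le1_minor M (i j k l : 'I_4) :
  rank_le1 M -> M i j * M k l = M i l * M k j.
Proof. by move=> [u [v ->]]; rewrite !mxE !big_ord1; ring. Qed.

Lemma rank_le1_Xa2b s : rank_le1 (bor 0 0 0 0 0 s).
Proof.
exists (\col_i [:: s; 0; 0; 0]`_i), (\row_j [:: 0; 0; 1; 0]`_j).
by rewrite /bor; mx4_entries; ring.
Qed.

Lemma rank_le1_Xa : rank_le1 (bor 0 0 1 0 0 0).
Proof.
exists (\col_i [:: 0; 1; 0; 0]`_i), (\row_j [:: 0; 0; 0; 1]`_j).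
by rewrite /bor; mx4_entries; ring.
Qed.

Lemma line4_rank_le1_not_closed : rank_le1_not_closed (line4 F).
Proof.
exists (bor 0 0 1 0 0 0), (bor 0 0 0 0 0 1); split.
- by apply/memv_line4; exists 0, 1, 0.
- by apply/memv_line4; exists 0, 0, 1.
- exact: rank_le1_Xa.
- exact: rank_le1_Xa2b.
rewrite borD => /(@rank_le1_minor _ 0 2%:R 1 3%:R).
by rewrite !mxE /= !addr0 add0r mulr1 mulr0 => /eqP; rewrite oner_eq0.
Qed.

(** As p = q = 0 here, two vanishing minors of the first two rows say that the [Xab] and torus
    coordinates have square 0. *)
Lemma line3_rank_le1 M : M \in line3 F -> rank_le1 M ->
  exists s, M = bor 0 0 0 0 0 s.
Proof.
move=> /memv_line3[x [y [z ->]]] rM; exists z.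
have := @rank_le1_minor _ 0 3%:R 1 2%:R rM; rewrite !mxE /= mulr0 => /eqP.
rewrite mulf_eq0 orbb => /eqP->.
have := @rank_le1_minor _ 0 0 1 1 rM; rewrite !mxE /= mulr0 => /eqP.
by rewrite mulf_eq0 orbb => /eqP->.
Qed.

Lemma line3_rank_le1_closed : ~ rank_le1_not_closed (line3 F).
Proof.
case=> Y [Z [YS ZS /(line3_rank_le1 YS)[s ->] /(line3_rank_le1 ZS)[t ->]]].
by rewrite borD !addr0; apply; apply: rank_le1_Xa2b.
Qed.

(** By symmetry six pairs remain: the center settles three, opposite weights two, and rank the pair
    formed by the third and fourth lines. *)
Lemma line_equiv_inj (i j : 'I_4) :
  sp4_equiv (nth 0%VS [:: line1 F; line2 F; line3 F; line4 F] i)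
            (nth 0%VS [:: line1 F; line2 F; line3 F; line4 F] j) -> i = j.
Proof.
wlog le_ij : i j / (i <= j)%N => [wlog_le|].
  case/orP: (leq_total i j) => [|le_ji]; first exact: wlog_le.
  by move=> /sp4_equiv_sym /(wlog_le _ _ le_ji).
case: i j le_ij => -[|[|[|[|//]]]] ? [[|[|[|[|//]]]] ?] //= _ eqU;
  first [exact: val_inj | exfalso].
- exact/line2_no_center/(has_center_equiv eqU)/line1_center.
- exact/line3_no_center/(has_center_equiv eqU)/line1_center.
- exact/line4_no_center/(has_center_equiv eqU)/line1_center.
- exact/line3_no_opposite_weights/(has_opposite_weights_equiv
    eqU)/line2_opposite_weights.
- exact/line4_no_opposite_weights/(has_opposite_weights_equiv
    eqU)/line2_opposite_weights.
- exact/line3_rank_le1_closed/(rank_le1_not_closed_equiv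
    (sp4_equiv_sym eqU))/line4_rank_le1_not_closed.
Qed.

End Reduction.

(** * Assembly over the complex numbers *)

Local Open Scope complex_scope.

Theorem theorem7p7 (R : realType) :
  let C : fieldType := R[i] in
  let lines : seq (seq {vspace 'M[C]_4}) :=
    [:: [:: <<[:: T 1 (-1); Xab C; Xa2b C]>>%VS;
            <<[:: T 1 1;    Xb C;  Xa2b C]>>%VS];
        [:: <<[:: T 1 (-1); Xa C;  Xa2b C]>>%VS];
        [:: <<[:: T 1 (-1); Xb C;  Xa2b C]>>%VS;
            <<[:: T 1 1;    Xab C; Xa2b C]>>%VS];
        [:: <<[:: T 1 1;    Xa C;  Xa2b C]>>%VS]] in
  (forall S : {vspace 'M[C]_4},
     (S <= borel C)%VS -> lie_subalgebra S -> lie_solvable S ->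
     \dim S = 3%N ->
     (exists X : 'M[C]_4,
        [/\ X \in S, semisimple X &
            char_poly X = \prod_(c <- [:: 1; 1; -1; -1]) ('X - c%:P)]) ->
     ~ (exists2 H : {vspace 'M[C]_4}, cartan_subalgebra H & (H <= S)%VS) ->
     exists2 U, U \in flatten lines & sp4_equiv S U) /\
  (forall (i j : 'I_4) (U V : {vspace 'M[C]_4}),
     U \in nth [::] lines i -> V \in nth [::] lines j ->
     sp4_equiv U V <-> i = j).
Proof.
move=> C lines; pose F : numClosedFieldType := R[i]; split.
  move=> S SB clS _ dimS [X [XS ssX chX]] /torus_free_cartan TF.
  have := @classify F S X SB clS dimS TF XS (semisimple_sqr1 ssX chX).
  case=> eqS.
  (* The positions 1, 2, 4, 5 are those of the four representatives among the six listed algebras,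
     counted from 0. *)
  - by exists (line1 F); [exact: (@mem_nth _ 0%VS (flatten lines) 1 isT) |].
  - by exists (line2 F); [exact: (@mem_nth _ 0%VS (flatten lines) 2 isT) |].
  - by exists (line3 F); [exact: (@mem_nth _ 0%VS (flatten lines) 4 isT) |].
  - by exists (line4 F); [exact: (@mem_nth _ 0%VS (flatten lines) 5 isT) |].
(* Each listed algebra is equivalent to the representative of its line, which reduces both
   directions to representatives. *)
have repr (i : 'I_4) U : U \in nth [::] lines i ->
    sp4_equiv U (nth 0%VS [:: line1 F; line2 F; line3 F; line4 F] i).
  case: i => -[|[|[|[|//]]]] ? /=; rewrite !inE.
  - by case/orP=> /eqP->; [exact: (line1'_equiv F) | exact: sp4_equiv_refl].
  - by move/eqP->; exact: sp4_equiv_refl.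
  - by case/orP=> /eqP->; [exact: (line3'_equiv F) | exact: sp4_equiv_refl].
  - by move/eqP->; exact: sp4_equiv_refl.
move=> i j U V /repr eqU /repr eqV; split=> [eqUV|ij].
  apply: (@line_equiv_inj F).
  apply: sp4_equiv_trans eqV.
  exact: sp4_equiv_trans (sp4_equiv_sym eqU) eqUV.
by move: eqV; rewrite -ij => /sp4_equiv_sym; exact: sp4_equiv_trans.
Qed.
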